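(* Let $G$ be an infinite residually finite abelian group. Then $$\log|G|\leq w(G,\nu_G)=d(G,\gamma_G)=d(G,\nu_G)=\omega\cdot\sup\{|G/pG|: p\text{ prime}\}.$$
   Context: An abelian group is residually finite if it is isomorphic to a subgroup of a direct product of finite abelian groups. The profinite topology $\gamma_G$ is the group topology on $G$ having all finite-index subgroups of $G$ as a base of neighborhoods of $0$. The natural topology $\nu_G$ is the group topology on $G$ having $\{mG:m\in\mathbb N_+\}$ as a base of neighborhoods of $0$, where $\mathbb N_+$ is the set of positive integers and $mG=\{mx:x\in G\}$. The weight $w(G,\tau)$ is the minimum cardinality of a base of the topology $\tau$; the density character $d(G,\tau)$ is the minimum cardinality of a dense subset of $(G,\tau)$. For an infinite cardinal $\kappa$, $\log\kappa=\min\{\lambda: 2^\lambda\geq\kappa\}$, where $\lambda$ ranges over cardinals. *)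

(* Defs.v *)
From HB Require Import structures.
From mathcomp Require Import all_boot all_order all_algebra.
From mathcomp Require Import all_classical all_reals all_analysis.

Set Implicit Arguments.
Unset Strict Implicit.
Unset Printing Implicit Defensive.

Import Order.TTheory GRing.Theory.

Local Open Scope classical_set_scope.
Local Open Scope card_scope.
Local Open Scope quotient_scope.
Local Open Scope ring_scope.

Definition equipotent (X Y : Type) : Prop := [set: Y] #= [set: X].

(* A cardinal is an equipotence class of types. This lives one universe above
   the carriers of the library structures, so [cardinal] cannot itself be given
   a [choiceType] or [porderType] structure, nor be an argument of [set]. *)
Definition cardinal := {c : Type -> Prop | exists X, c = equipotent X}.

Definition card_of (X : Type) : cardinal :=
  exist _ (equipotent X) (ex_intro _ X erefl).

(* A type of cardinality [k]. *)
Definition carrier (k : cardinal) : Type := projT1 (cid (proj2_sig k)).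

Lemma carrierK (k : cardinal) : card_of (carrier k) = k.
Proof.
rewrite /carrier; case: k => c cP; case: cid => /= X cX.
exact/eq_exist/esym.
Qed.

Lemma card_of_eq (X Y : Type) :
  (card_of X = card_of Y) <-> [set: X] #= [set: Y].
Proof.
split=> [/(congr1 (fun k => proj1_sig k X))/= XY|XY].
  by rewrite -/(equipotent Y X) -XY; exact: card_eqxx.
apply: eq_exist; apply/funext => Z; apply/propext.
by rewrite /equipotent (card_eqr XY).
Qed.

Lemma carrier_card_of (X : Type) : [set: carrier (card_of X)] #= [set: X].
Proof. by apply/card_of_eq; rewrite carrierK. Qed.

Definition cardinal_le (k l : cardinal) : Prop :=
  [set: carrier k] #<= [set: carrier l].

Lemma cardinal_le_refl k : cardinal_le k k.
Proof. exact: card_lexx. Qed.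

Lemma cardinal_le_anti k l : cardinal_le k l -> cardinal_le l k -> k = l.
Proof.
move=> kl lk; rewrite -(carrierK k) -(carrierK l).
by apply/card_of_eq; rewrite card_eq_le; apply/andP.
Qed.

Lemma cardinal_le_trans k l m :
  cardinal_le k l -> cardinal_le l m -> cardinal_le k m.
Proof. exact: card_le_trans. Qed.

Lemma card_of_le (X Y : Type) :
  cardinal_le (card_of X) (card_of Y) <-> [set: X] #<= [set: Y].
Proof.
by rewrite /cardinal_le (card_le_eql (carrier_card_of X))
  (card_le_eqr (carrier_card_of Y)).
Qed.

Definition omega : cardinal := card_of nat.
Definition cardinal_mul (k l : cardinal) : cardinal :=
  card_of (carrier k * carrier l).
Definition cardinal_exp2 (k : cardinal) : cardinal := card_of (carrier k -> bool).

Definition is_min (E : cardinal -> Prop) (k : cardinal) : Prop :=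
  E k /\ forall l, E l -> cardinal_le k l.

(* The default value [card_of void] is only used when [E] is empty: see
   [cardinal_minP]. *)
Definition cardinal_min (E : cardinal -> Prop) : cardinal :=
  if pselect (exists k, is_min E k) is left minE then projT1 (cid minE)
  else card_of void.

Definition cardinal_sup (I : Type) (k : I -> cardinal) : cardinal :=
  cardinal_min (fun l => forall i, cardinal_le (k i) l).

Definition cardinal_log (k : cardinal) : cardinal :=
  cardinal_min (fun l => cardinal_le k (cardinal_exp2 l)).

(* Choose a maximal set [F] of elements of the product of the family on which
   all projections are injective: some projection of [F] is onto, and it
   exhibits the smallest type. *)
Lemma smallest_type (I : Type) (X : I -> Type) : inhabited I ->
  exists i, forall j, [set: X i] #<= [set: X j].
Proof.
move=> [i0].
pose good (F : set (forall i, X i)) :=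
  forall f g i, F f -> F g -> f i = g i -> f = g.
have [F [goodF maxF]] : exists F, good F /\ forall F', F `<` F' -> ~ good F'.
  apply: (@Zorn_bigcup _ good) => C Cgood Ctot f g i [A CA Af] [B CB Bg].
  by case: (Ctot _ _ CA CB) => AB;
    [apply: (Cgood _ CB) => //; exact: AB|apply: (Cgood _ CA) => //; exact: AB].
have [i Fi] : exists i, forall x : X i, exists2 f, F f & f i = x.
  apply: contrapT => /forallNP noi.
  have {}noi i : exists x : X i, forall f, F f -> f i <> x.
    have /existsNP[x nx] := noi i; exists x => f Ff fx; apply: nx.
    by exists f.
  pose g i := projT1 (cid (noi i)).
  have gP i f : F f -> f i <> g i by exact: (projT2 (cid (noi i))).
  apply: (maxF (g |` F)).
    rewrite properEneq; split; last by right.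
    apply/eqP => FE; apply: (gP i0 g) => //; by rewrite FE; left.
  move=> f h i [->|Ff] [->|Fh]//; first by move=> /esym /gP; case.
  - by move=> /gP; case.
  - exact: goodF.
exists i => j.
pose s x := projT1 (cid2 (Fi x)).
have sF x : F (s x) by rewrite /s; case: cid2.
have sx x : s x i = x by rewrite /s; case: cid2.
have s_inj : injective (fun x => s x j).
  by move=> x y /(goodF _ _ _ (sF x) (sF y)) sxy; rewrite -(sx x) sxy.
have imX : (fun x => s x j) @` [set: X i] #= [set: X i].
  by apply: inj_card_eq => x y _ _; exact: s_inj.
by rewrite -(card_le_eql imX); exact: card_leT.
Qed.

Lemma cardinal_le_total k l : cardinal_le k l \/ cardinal_le l k.
Proof.
have [|[] min] := @smallest_type bool (fun b => carrier (if b then k else l)).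
- by constructor; exact: true.
- by left; exact: (min false).
- by right; exact: (min true).
Qed.

Lemma card_le_sig (X Y : Type) : [set: X] #<= [set: Y] ->
  exists A : Y -> Prop, [set: X] #= [set: {y | A y}].
Proof.
move=> /card_subP[A AX _]; exists A; rewrite card_eq_sym in AX.
apply: (card_eq_trans AX).
have AE : A = @proj1_sig _ _ @` [set: {y | A y}].
  by apply/seteqP; split=> [y Ay|y [[z Az] _ <-]//]; exists (exist _ y Ay).
rewrite [X in X #= _]AE; apply: inj_card_eq => -[y Ay] [z Az] _ _ /= yz.
exact: eq_exist.
Qed.

Lemma cardinal_minP (E : cardinal -> Prop) :
  (exists k, E k) -> is_min E (cardinal_min E).
Proof.
move=> [k Ek]; rewrite /cardinal_min; case: pselect => [?|noE].
  by case: cid.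
exfalso; apply: noE.
pose I := {A : carrier k -> Prop | E (card_of {x | A x})}.
have subE l : E l -> cardinal_le l k ->
    exists A : I, card_of {x | proj1_sig A x} = l.
  move=> El /card_le_sig[A /card_of_eq]; rewrite carrierK => lA.
  by rewrite lA in El; exists (exist _ A El).
have [K KE] := subE k Ek (cardinal_le_refl k).
have [|A Amin] := @smallest_type I (fun A => {x | proj1_sig A x}).
  by constructor.
exists (card_of {x | proj1_sig A x}); split; first exact: (proj2_sig A).
move=> l El; have [lk|kl] := cardinal_le_total l k.
  by have [B <-] := subE l El lk; apply/card_of_le.
apply: cardinal_le_trans kl.
have : cardinal_le (card_of {x | proj1_sig A x}) (card_of {x | proj1_sig K x}).
  by apply/card_of_le.
by rewrite KE.
Qed.

Lemma cardinal_sup_ge (I : Type) (k : I -> cardinal) i :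
  cardinal_le (k i) (cardinal_sup k).
Proof.
move: k i; elim/Peq: I => I k i.
have [+ _] : is_min (fun l => forall i, cardinal_le (k i) l) (cardinal_sup k).
  apply: cardinal_minP; exists (card_of {j : I & carrier (k j)}); move=> j.
  rewrite -(carrierK (k j)); apply/card_of_le.
  pose e := existT (fun j => carrier (k j)) j.
  have imj : e @` [set: carrier (k j)] #= [set: carrier (k j)].
    by apply: inj_card_eq => x y _ _; exact: existT_inj2.
  by rewrite -(card_le_eql imj); exact: card_leT.
exact.
Qed.

Lemma cardinal_sup_le (I : Type) (k : I -> cardinal) l :
  (forall i, cardinal_le (k i) l) -> cardinal_le (cardinal_sup k) l.
Proof.
move=> kl; have [_] : is_min (fun l => forall i, cardinal_le (k i) l) (cardinal_sup k).
  by apply: cardinal_minP; exists l.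
exact.
Qed.

Definition weight (T : topologicalType) : cardinal :=
  cardinal_min (fun k => exists2 B, @basis T B & k = card_of (set_type B)).

Definition density (T : topologicalType) : cardinal :=
  cardinal_min (fun k => exists2 D, @dense T D & k = card_of (set_type D)).

Section SubgroupTopology.
Variable G : zmodType.

Definition filter_base (B : set (zmodClosed G)) := B !=set0 /\
  forall H K, B H -> B K -> exists2 L, B L & forall x,
    x \in L -> (x \in H) && (x \in K).

Variables (B : set (zmodClosed G)) (baseB : filter_base B).

Definition translate (H : zmodClosed G) (x : G) : set G :=
  [set y | y - x \in H].

Definition subgroup_nbhs (x : G) : set_system G := filter_from B (translate^~ x).

Lemma subgroup_nbhs_filter x : ProperFilter (subgroup_nbhs x).
Proof.
have [B0 BI] := baseB.
apply: filter_from_proper; last first.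
  by move=> H BH; exists x; rewrite /translate/= subrr rpred0.
apply: filter_from_filter => // H K BH BK.
by have [L BL LHK] := BI _ _ BH BK; exists L => // y /LHK/andP[].
Qed.

Lemma subgroup_nbhs_singleton x (A : set G) : subgroup_nbhs x A -> A x.
Proof. by move=> [H _]; apply; rewrite /translate/= subrr rpred0. Qed.

Lemma subgroup_nbhs_nbhs x (A : set G) :
  subgroup_nbhs x A -> subgroup_nbhs x (subgroup_nbhs^~ A).
Proof.
move=> [H BH HA]; exists H => // y Hy; exists H => // z Hz.
by apply: HA; rewrite /translate/= -(subrKA y) rpredD.
Qed.

(* [G] with the topology in which [B] is a base of neighborhoods of 0. *)
Definition subgroup_topology of filter_base B : Type := G.

Local Notation T := (subgroup_topology baseB).

HB.instance Definition _ := GRing.Zmodule.on T.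
HB.instance Definition _ := hasNbhs.Build T subgroup_nbhs.
HB.instance Definition _ := Nbhs_isNbhsTopological.Build T
  subgroup_nbhs_filter subgroup_nbhs_singleton subgroup_nbhs_nbhs.

Lemma subgroup_sub_continuous : continuous (fun x : T * T => x.1 - x.2).
Proof.
move=> [x y] A [H BH HA].
exists (translate H x, translate H y); first by split; exists H.
move=> [x' y'] [/= Hx Hy]; apply: HA; rewrite /translate/= in Hx Hy *.
have subrACA (a b c d : G) : (a - b) - (c - d) = (a - c) - (b - d).
  by rewrite opprD addrACA -opprD.
suff : (x' : G) - y' - (x - y) \in H by [].
by rewrite subrACA rpredB.
Qed.

HB.instance Definition _ :=
  PreTopologicalNmodule_isTopologicalZmodule.Build T subgroup_sub_continuous.

End SubgroupTopology.

Section Multiples.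
Variables (G : zmodType) (m : nat).

Definition multiples : {pred G} := fun x => `[< exists y : G, x = y *+ m >].

Lemma multiples_zmod_closed : zmod_closed multiples.
Proof.
split; first by apply/asboolP; exists 0; rewrite mul0rn.
move=> _ _ /asboolP[x ->] /asboolP[y ->].
by apply/asboolP; exists (x - y); rewrite mulrnBl.
Qed.

HB.instance Definition _ := GRing.isZmodClosed.Build G multiples
  multiples_zmod_closed.
End Multiples.

Arguments multiples : clear implicits.

Section Intersection.
Variables (G : zmodType) (H K : zmodClosed G).

Definition intersection : {pred G} := fun x => (x \in H) && (x \in K).

Lemma intersection_zmod_closed : zmod_closed intersection.
Proof.
split=> [|x y /andP[xH xK] /andP[yH yK]]; apply/andP; first by rewrite !rpred0.
by split; exact: rpredB.
Qed.

HB.instance Definition _ := GRing.isZmodClosed.Build G intersection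
  intersection_zmod_closed.
End Intersection.

Section Topologies.
Variable G : zmodType.

Definition natural_base : set (zmodClosed G) :=
  [set (multiples G m : zmodClosed G) | m in [set m | (0 < m)%N]].

Definition profinite_base : set (zmodClosed G) :=
  [set H : zmodClosed G | finite_set [set: Quotient.quot H]].

Lemma quot_inj (H : zmodClosed G) (x y : Quotient.quot H) :
  repr x - repr y \in H -> x = y.
Proof. by rewrite Quotient.idealrBE !reprK => /eqP. Qed.

Lemma natural_filter_base : filter_base natural_base.
Proof.
split; first by exists (multiples G 1 : zmodClosed G), 1%N.
move=> _ _ [m m0 <-] [n n0 <-].
exists (multiples G (m * n) : zmodClosed G).
  by exists (m * n)%N => //=; rewrite muln_gt0 m0.
move=> _ /asboolP[y ->]; apply/andP; split; apply/asboolP.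
- by exists (y *+ n); rewrite -mulrnA mulnC.
- by exists (y *+ m); rewrite -mulrnA.
Qed.

Lemma profinite_filter_base : filter_base profinite_base.
Proof.
split.
  exists (multiples G 1 : zmodClosed G); apply: sub_finite_set (finite_set1 0).
  by move=> x _ /=; apply: quot_inj; apply/asboolP; eexists; rewrite mulr1n.
move=> H K finH finK; exists (intersection H K : zmodClosed G) => //.
pose f (x : Quotient.quot (intersection H K)) :=
  (\pi_(Quotient.quot H) (repr x), \pi_(Quotient.quot K) (repr x)).
have f_inj : injective f.
  move=> x y [/eqP + /eqP]; rewrite -!Quotient.idealrBE => xyH xyK.
  by apply: quot_inj; apply/andP.
apply: (@card_le_finite _ _ _ ([set: Quotient.quot H] `*` [set: Quotient.quot K])).
  have imf : f @` setT #= [set: Quotient.quot (intersection H K)].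
    by apply: inj_card_eq => x y _ _; exact: f_inj.
  by rewrite -(card_le_eql imf); exact: subset_card_le.
exact: finite_setX.
Qed.

Definition natural_topology := subgroup_topology natural_filter_base.
Definition profinite_topology := subgroup_topology profinite_filter_base.

Definition residually_finite :=
  exists (I : Type) (F : I -> finZmodType) (f : G -> forall i, F i),
    (forall x y i, f (x + y) i = f x i + f y i) /\ injective f.

End Topologies.

(* Main.v *)
(* Let K be the right-hand cardinal. The quotients G/mG are iterated extensions
   of quotients G/pG, so they have at most K elements, and the cosets of the
   subgroups mG form a base of the natural topology of cardinality at most K.
   A space has density at most its weight, and the natural topology is finer
   than the profinite one, because n!G lies in every subgroup of index n.
   Conversely, if D is dense in the profinite topology then D is infinite, as
   that topology is Hausdorff, and D generates G modulo pG, because every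
   subgroup containing pG is an intersection of subgroups of index p; hence
   |G/pG| <= |D|. Finally a T0 space embeds in the power set of any base. *)
Require Import Defs.
From HB Require Import structures.
From mathcomp Require Import all_boot all_order all_algebra.
From mathcomp Require Import all_classical all_reals all_analysis.

Local Open Scope classical_set_scope.

Set Implicit Arguments.
Unset Strict Implicit.
Unset Printing Implicit Defensive.

Import GRing.Theory.

Local Open Scope card_scope.
Local Open Scope quotient_scope.
Local Open Scope ring_scope.

(** * Cardinal inequalities as injections *)

Lemma proj1_sig_inj (T : Type) (P : T -> Prop) : injective (@proj1_sig T P).
Proof. by move=> [x Px] [y Py] /= xy; exact: eq_exist. Qed.

Lemma card_leTP (X Y : Type) :
  [set: X] #<= [set: Y] <-> exists f : X -> Y, injective f.
Proof.
split=> [|[f f_inj]].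
  elim/Ppointed: Y => Y.
    rewrite emptyE => /eqP X0.
    have nX (x : X) : False by have : [set: X] x by []; rewrite X0.
    by exists (fun x => match nX x with end) => x; case: (nX x).
  move=> /pcard_injP[f f_inj]; exists f => x x' fx.
  by apply: f_inj; rewrite ?inE.
have imf : f @` [set: X] #= [set: X].
  by apply: inj_card_eq => x x' _ _; exact: f_inj.
by rewrite -(card_le_eql imf); exact: card_leT.
Qed.

Lemma card_leT_surj (X Y : Type) (f : X -> Y) :
  (forall y, exists x, f x = y) -> [set: Y] #<= [set: X].
Proof.
move=> f_surj; apply/card_leTP; exists (fun y => projT1 (cid (f_surj y))).
by move=> y y'; case: cid => x /= <-; case: cid => x' /= <- ->.
Qed.

Lemma card_leT_prod (X X' Y Y' : Type) : [set: X] #<= [set: X'] ->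
  [set: Y] #<= [set: Y'] -> [set: X * Y] #<= [set: X' * Y'].
Proof.
move=> /card_leTP[f f_inj] /card_leTP[g g_inj]; apply/card_leTP.
exists (fun u => (f u.1, g u.2)) => -[x y] [x' y'] /= [].
by move=> /f_inj -> /g_inj ->.
Qed.

(** Zorn's lemma is applied to the sets whose union with [A0] satisfies [P]: the empty chain is then
    settled by [P A0], which leaves only nonempty chains to check. *)
Lemma Zorn_bigcup_above (T : Type) (P : set (set T)) (A0 : set T) : P A0 ->
  (forall F : set (set T), F !=set0 -> F `<=` P -> total_on F subset ->
    P (\bigcup_(A in F) A)) ->
  exists A, [/\ P A, A0 `<=` A & forall B, A `<` B -> ~ P B].
Proof.
move=> PA0 Pchain.
have [F FP Ftot|A [PA Amax]] := @Zorn_bigcup T [set A | P (A `|` A0)].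
  have [->|/set0P[A FA]] := eqVneq F set0.
    by rewrite /= bigcup_set0 set0U.
  have -> : [set A | P (A `|` A0)] (\bigcup_(A in F) A) =
      P (\bigcup_(B in [set B `|` A0 | B in F]) B).
    congr P; apply/seteqP; split=> [t [[B FB Bt]|A0t]|t [_ [B FB <-] [Bt|A0t]]].
    - by exists (B `|` A0); [exists B|left].
    - by exists (A `|` A0); [exists A|right].
    - by left; exists B.
    - by right.
  apply: Pchain; first by exists (A `|` A0), A.
  - by move=> _ [B /FP PB <-].
  - by move=> _ _ [B FB <-] [C FC <-]; have [BC|CB] := Ftot _ _ FB FC;
      [left|right]; exact: setSU.
exists (A `|` A0); split=> // B [AB nBA] PB; apply: (Amax B) => /=.
  split; first by move=> t At; apply: AB; left.
  by move=> BA; apply: nBA => t /BA; left.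
by rewrite setUidl// => t A0t; apply: AB; right.
Qed.

(** * Squares of infinite cardinals *)

Section InfiniteSquare.
Variable X : Type.

Let field (R : set (X * X * X)) (a : X) := exists b c, R (a, b, c).

(* [R] is the graph of an injection from [field R * field R] to [field R],
   except that it may be multivalued. *)
Let pairing (R : set (X * X * X)) :=
  [/\ forall a b, field R a -> field R b -> exists c, R (a, b, c),
      forall a b c, R (a, b, c) -> field R b /\ field R c &
      forall a b a' b' c, R (a, b, c) -> R (a', b', c) -> (a, b) = (a', b')].

Let pairing_bigcup (F : set (set (X * X * X))) : F !=set0 -> F `<=` pairing ->
  total_on F subset -> pairing (\bigcup_(R in F) R).
Proof.
move=> _ Fpair Ftot.
have field_bigcup R a : F R -> field R a -> field (\bigcup_(R in F) R) a.
  by move=> FR [b [c abc]]; exists b, c, R.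
split.
- move=> a b [x [y [R FR Ra]]] [x' [y' [S FS Sb]]].
  have [T FT [Ta Tb]] : exists2 T, F T & field T a /\ field T b.
    have [RS|SR] := Ftot _ _ FR FS.
      by exists S => //; split; [exists x, y; exact: RS|exists x', y'].
    by exists R => //; split; [exists x, y|exists x', y'; exact: SR].
  have [total _ _] := Fpair _ FT.
  by have [c Tabc] := total _ _ Ta Tb; exists c, T.
- move=> a b c [R FR Rabc]; have [_ clos _] := Fpair _ FR.
  have [Rb Rc] := clos _ _ _ Rabc.
  by split; [exact: field_bigcup Rb|exact: field_bigcup Rc].
- move=> a b a' b' c [R FR Rabc] [S FS Sabc].
  have [RS|SR] := Ftot _ _ FR FS.
    by have [_ _ inj] := Fpair _ FS; apply: inj Sabc; exact: RS.
  by have [_ _ inj] := Fpair _ FR; apply: inj Rabc _; exact: SR.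
Qed.

(** Take a maximal pairing above a countable one, with field [D], so that |D x D| <= |D|. If the
    complement of [D] embeds in [D], then |X| <= 2|D| <= |D|. Otherwise [D] embeds in its complement
    and the pairing extends, against maximality. *)
Lemma infinite_card_square :
  infinite_set [set: X] -> [set: X * X] #<= [set: X].
Proof.
move=> /infiniteP/card_leTP[e e_inj].
have [p p_inj] : exists p : nat * nat -> nat, injective p.
  by apply/card_leTP; have := card_nat2; rewrite card_eq_le => /andP[].
(* A pairing of the naturals carried along [e]. It starts the Zorn argument and puts two distinct
   points into the field, whence 2|D| <= |D x D|. *)
pose R0 : set (X * X * X) := [set u | exists i j, u = (e i, e j, e (p (i, j)))].
have fieldR0 i : field R0 (e i) by exists (e 0%N), (e (p (i, 0%N))), i, 0%N.
have pairR0 : pairing R0.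
  split.
  - move=> _ _ [_ [_ [i [_ [-> _ _]]]]] [_ [_ [j [_ [-> _ _]]]]].
    by exists (e (p (i, j))), i, j.
  - by move=> _ _ _ [i [j [_ -> ->]]].
  - by move=> _ _ _ _ _ [i [j [-> -> ->]]] [i' [j' [-> -> /e_inj/p_inj[-> ->]]]].
have [R [[Rtotal Rclos Rinj] R0R Rmax]] :=
  Zorn_bigcup_above pairR0 pairing_bigcup.
pose D := {a | field R a}.
have DD : [set: D * D] #<= [set: D].
  apply/card_leTP.
  have /choice[c cP] (u : D * D) :
      exists c, R (proj1_sig u.1, proj1_sig u.2, c).
    exact: Rtotal (proj2_sig u.1) (proj2_sig u.2).
  exists (fun u => exist _ (c u) (proj2 (Rclos _ _ _ (cP u)))).
  move=> [a b] [a' b'] /(congr1 (@proj1_sig _ _))/= cE.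
  have := cP (a', b'); rewrite -cE => /(Rinj _ _ _ _ _ (cP (a, b)))[].
  by move=> aa bb; congr (_, _); exact: proj1_sig_inj.
have boolD : [set: bool * D] #<= [set: D].
  apply: card_le_trans DD; apply: card_leT_prod (card_lexx _).
  apply/card_leTP.
  have De i : field R (e i).
    by exists (e 0%N), (e (p (i, 0%N))); apply: R0R; exists i, 0%N.
  exists (fun b : bool => exist _ (e b) (De b)).
  by move=> [] [] // /(congr1 (@proj1_sig _ _))/= /e_inj.
have [|] := cardinal_le_total (card_of {a | ~ field R a}) (card_of D).
  move=> /card_of_le /card_leTP[h h_inj].
  have XD : [set: X] #<= [set: D].
    apply: card_le_trans boolD; apply/card_leTP.
    exists (fun x => match pselect (field R x) with
      | left Rx => (true, exist _ x Rx)
      | right nRx => (false, h (exist _ x nRx)) end).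
    move=> x y; case: pselect => Rx; case: pselect => Ry // [].
      by [].
    by move=> /h_inj/(congr1 (@proj1_sig _ _)).
  apply: card_le_trans (card_leT_prod XD XD) _; apply: card_le_trans DD _.
  by apply/card_leTP; exists (@proj1_sig _ _); exact: proj1_sig_inj.
move=> /card_of_le /card_leTP[h h_inj]; exfalso.
have /card_leTP[q q_inj] := card_le_trans (card_leT_prod boolD boolD) DD.
(* [v] parametrizes the enlarged field: [false] gives [D] itself, [true] its copy under [h] outside
   [D]. *)
pose v (u : bool * D) := if u.1 then proj1_sig (h u.2) else proj1_sig u.2.
have v_inj : injective v.
  move=> [[] a] [[] b]; rewrite /v/= => vE.
  - by rewrite (h_inj _ _ (proj1_sig_inj vE)).
  - by case: (proj2_sig (h a)); rewrite vE; exact: (proj2_sig b).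
  - by case: (proj2_sig (h b)); rewrite -vE; exact: (proj2_sig a).
  - by rewrite (proj1_sig_inj vE).
(* Every pair of the enlarged field receives a value in the copy, even a pair of [D] that already
   has one; hence the multivalued relations. Old values lie in [D], so they never collide with the
   new ones. *)
pose R' := R `|` [set z | exists u w, z = (v u, v w, v (true, q (u, w)))].
have fieldv u : field R' (v u).
  by exists (v u), (v (true, q (u, u))); right; exists u, u.
have fieldR'P a : field R' a -> exists u, a = v u.
  move=> [b [c [Rabc|[u [w [-> _ _]]]]]]; last by exists u.
  have Ra : field R a by exists b, c.
  by exists (false, exist _ a Ra).
have old_new a b u : R (a, b, v (true, u)) -> False.
  by move=> /Rclos[_]; exact: (proj2_sig (h u)).
apply: (Rmax R'); last split.
- split; first by move=> z Rz; left.
  pose d := exist _ (e 0%N) (let: ex_intro b (ex_intro c bc) := fieldR0 0%N in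
    ex_intro _ b (ex_intro _ c (R0R _ bc))) : D.
  move=> /(_ (v (true, d), v (true, d), v (true, q ((true, d), (true, d))))).
  by move=> /(_ _)/old_new; apply; right; exists (true, d), (true, d).
- move=> _ _ /fieldR'P[u ->] /fieldR'P[w ->].
  by exists (v (true, q (u, w))); right; exists u, w.
- move=> a b c [Rabc|[u [w [_ -> ->]]]]; last by split; exact: fieldv.
  have [Rb Rc] := Rclos _ _ _ Rabc.
  by split; [exact: (fieldv (false, exist _ b Rb))|
             exact: (fieldv (false, exist _ c Rc))].
- move=> a b a' b' c [Rabc|[u [w [-> -> cE]]]] [Rabc'|[u' [w' [-> -> cE']]]].
  + exact: Rinj Rabc Rabc'.
  + by move: Rabc; rewrite cE' => /old_new.
  + by move: Rabc'; rewrite cE => /old_new.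
  + by move: cE; rewrite cE' => /v_inj[/q_inj[-> ->]].
Qed.

End InfiniteSquare.

(** A list is coded by its length and the iterated pairing of its entries; the length tells how
    often to unpair. *)
Lemma infinite_card_seq (X : Type) :
  infinite_set [set: X] -> [set: seq X] #<= [set: X].
Proof.
move=> Xinf; have XX := infinite_card_square Xinf.
have NX : [set: nat] #<= [set: X] by apply/infiniteP.
have /card_leTP[j j_inj] := XX.
have [x0 _] := infinite_setN0 Xinf.
apply: card_le_trans (card_le_trans (card_leT_prod NX (card_lexx _)) XX).
apply/card_leTP; exists (fun s => (size s, foldr (fun x y => j (x, y)) x0 s)).
elim=> [|x s IHs] [|y t] //= [st /j_inj[-> stj]].
by congr cons; apply: IHs; rewrite st stj.
Qed.

Lemma prop_cardinal_min (E : cardinal -> Prop) k :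
  E k -> cardinal_le (cardinal_min E) k.
Proof. by move=> Ek; have [|_] := @cardinal_minP E; [exists k|exact]. Qed.

(** * Weight and density of a topological space *)

Section TopologicalCardinals.
Variable T : topologicalType.

Lemma weightP : exists2 B, @basis T B & weight T = card_of (set_type B).
Proof.
have [|+ _] := @cardinal_minP
  (fun k => exists2 B, @basis T B & k = card_of (set_type B)); last exact.
exists (card_of (set_type (@open T))), (@open T) => //; split=> // x A.
by rewrite nbhsE => -[U [oU Ux] UA]; exists U.
Qed.

Lemma weight_le B : @basis T B -> cardinal_le (weight T) (card_of (set_type B)).
Proof. by move=> basisB; apply: prop_cardinal_min; exists B. Qed.

Lemma densityP : exists2 D, @dense T D & density T = card_of (set_type D).
Proof.
have [|+ _] := @cardinal_minP
  (fun k => exists2 D, @dense T D & k = card_of (set_type D)); last exact.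
exists (card_of (set_type [set: T])), setT => //.
by move=> A [x Ax] _; exists x.
Qed.

Lemma density_le D : @dense T D ->
  cardinal_le (density T) (card_of (set_type D)).
Proof. by move=> denseD; apply: prop_cardinal_min; exists D. Qed.

(** One point chosen in each nonempty basic set gives a dense set. *)
Lemma density_le_weight : cardinal_le (density T) (weight T).
Proof.
have [B [Bopen Bnbhs] ->] := weightP.
(* The point [t0] is the default choice for an empty basic set; the empty space is treated apart. *)
have [[t0 _]|T0] := pselect (exists t : T, True); last first.
  have /density_le /cardinal_le_trans : @dense T set0.
    by move=> A [x]; case: T0; exists x.
  apply; apply/card_of_le.
  by rewrite (card_le_eql (card_setT _)); exact: card_ge0.
have /choice[c cP] (U : set_type B) : exists x, val U !=set0 -> val U x.
  have [->|/set0P[x Ux]] := eqVneq (val U) set0; last by exists x.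
  by exists t0 => -[].
have denseD : @dense T (range c).
  move=> A [x Ax] oA.
  have [|U [BU Ux] UA] := Bnbhs x A; first exact: open_nbhs_nbhs.
  pose U' : set_type B := exist _ U (mem_set BU).
  by exists (c U'); split; [apply: UA; apply: (cP U'); exists x|exists U'].
apply: cardinal_le_trans (density_le denseD) _; apply/card_of_le.
by rewrite (card_le_eql (card_setT _)); exact: card_image_le.
Qed.

Lemma card_le_exp2_weight : kolmogorov_space T ->
  cardinal_le (card_of T) (cardinal_exp2 (weight T)).
Proof.
move=> T0; have [B [_ Bnbhs] ->] := weightP.
have := carrier_card_of (set_type B).
rewrite card_eq_le => /andP[_ /card_leTP[g g_inj]].
rewrite /cardinal_exp2; apply/card_of_le/card_leTP.
(* A point goes to the set of basic open sets containing it, coded through [g]; the T0 axiom makes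
   this injective. *)
exists (fun x k => `[< exists U : set_type B, g U = k /\ val U x >]) => x y xy.
have {}xy U : B U -> U x <-> U y.
  move=> BU; pose U' : set_type B := exist _ U (mem_set BU).
  have [xy1 xy2] := asbool_eq_equiv (congr1 (@^~ (g U')) xy).
  by split=> Uz; [have [|V [/g_inj->]//] := xy1|have [|V [/g_inj->]//] := xy2];
    exists U'.
apply: contrapT => /eqP/T0[A]; rewrite !inE => -[] [Az nA]; apply: nA.
  by have [U [BU Ux] UA] := Bnbhs _ _ Az; exact/UA/(xy U BU).1.
by have [U [BU Ux] UA] := Bnbhs _ _ Az; exact/UA/(xy U BU).2.
Qed.

(** Finite sets are closed in a T1 space, so a finite dense set would be the whole infinite
    space. *)
Lemma dense_infinite D : accessible_space T -> infinite_set [set: T] ->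
  @dense T D -> infinite_set D.
Proof.
move=> /accessible_finite_set_closed T1 Tinf denseD /[dup] Dfin /T1 Dcl.
have [||x [? ?]//] := denseD (~` D); last by rewrite openC.
apply/set0P/eqP => /(congr1 (@setC T)); rewrite setCK setC0 => DE.
by apply: Tinf; rewrite -DE.
Qed.

End TopologicalCardinals.

(** * Topologies given by subgroups *)

Section SubgroupTopology.
Variables (G : zmodType) (B : set (zmodClosed G)) (baseB : filter_base B).
Local Notation T := (subgroup_topology baseB).

Lemma subgroup_openP (A : set T) :
  open A <-> forall x, A x -> exists2 H, B H & translate H x `<=` A.
Proof. by rewrite openE. Qed.

Lemma translate_open (H : zmodClosed G) (x : G) :
  B H -> @open T (translate H x).
Proof.
move=> BH; apply/subgroup_openP => y xy; exists H => // z yz.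
by rewrite /translate/= -(subrKA y) rpredD.
Qed.

Lemma translate_refl (H : zmodClosed G) (x : G) : translate H x x.
Proof. by rewrite /translate/= subrr rpred0. Qed.

Lemma subgroup_accessible :
  (forall x : G, x != 0 -> exists2 H, B H & x \notin H) -> accessible_space T.
Proof.
move=> sepB x y xy; have [|H BH nH] := sepB (y - x : G).
  by rewrite subr_eq0 eq_sym.
exists (translate H x); split; first exact: translate_open.
- by apply/mem_set; exact: translate_refl.
- by apply/mem_set => /= xyH; rewrite xyH in nH.
Qed.

End SubgroupTopology.

Lemma subgroup_topology_finer (G : zmodType) (B B' : set (zmodClosed G))
  (baseB : filter_base B) (baseB' : filter_base B') :
  (forall H, B H -> exists2 K : zmodClosed G, B' K & {subset K <= H}) ->
  forall A : set G, @open (subgroup_topology baseB) A ->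
    @open (subgroup_topology baseB') A.
Proof.
move=> BB' A /subgroup_openP oA.
apply/subgroup_openP => x /oA[H /BB'[K B'K KH] HA].
by exists K => // y /KH yH; exact: HA.
Qed.

(** A criterion for finite index: a finite colouring that tells the cosets apart suffices, additive
    or not. *)
Lemma profinite_baseP (G : zmodType) (H : zmodClosed G) (F : finType)
    (f : G -> F) :
  (forall x y, f x = f y -> x - y \in H) -> profinite_base H.
Proof.
move=> fH; apply: (@card_le_finite _ _ _ [set: F]); last exact: finite_finset.
apply/card_leTP; exists (fun x => f (repr x)) => x y /fH.
exact: quot_inj.
Qed.

Lemma natural_base_profinite (G : zmodType) (H : zmodClosed G) :
  profinite_base H ->
  exists2 K : zmodClosed G, natural_base K & {subset K <= H}.
Proof.
move=> /finite_setP[n]; rewrite card_eq_le => /andP[+ _].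
rewrite (card_le_eqr card_II) => /card_leTP[c c_inj].
exists (multiples G n`! : zmodClosed G).
  by exists n`! => //=; exact: fact_gt0.
move=> _ /asboolP[x ->].
(* Pigeonhole: the n+1 multiples 0, x, ..., nx fall into n classes modulo [H], so (j - i)x is in [H]
   for some 0 < j - i <= n, and j - i divides n!. *)
pose g (i : 'I_n.+1) := c (\pi_(Quotient.quot H) (x *+ i)).
have /injectivePn[i [j ij gij]] : ~~ injectiveb g.
  by apply/negP => /injectiveP/leq_card; rewrite !card_ord ltnn.
wlog {ij} ij : i j gij / (i < j)%N.
  move=> wl; case: (ltngtP i j) => [||/val_inj ij'].
  - exact: wl.
  - exact: wl.
  - by case/eqP: ij.
have /eqP : \pi_(Quotient.quot H) (x *+ j) = \pi_(Quotient.quot H) (x *+ i).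
  exact/esym/c_inj.
rewrite -Quotient.idealrBE -mulrnBr ?(ltnW ij)// => xH.
have /dvdnP[q ->] : (j - i %| n`!)%N.
  by apply: dvdn_fact; rewrite subn_gt0 ij (leq_trans (leq_subr _ _))// -ltnS.
by rewrite mulnC mulrnA rpredMn.
Qed.

(** * Separation by subgroups of finite index *)

Section KernelSubgroup.
Variables (G F : zmodType) (f : G -> F) (fD : {morph f : x y / x + y}).

(** The proof of additivity is an argument so that the subgroup structure can be inferred from the
    term. *)
Definition kernel of {morph f : x y / x + y} : {pred G} := fun x => f x == 0.

Lemma kernel_zmod_closed : zmod_closed (kernel fD).
Proof.
have f0 : f 0 = 0 by apply: (addrI (f 0)); rewrite -fD !addr0.
split=> [|x y /eqP fx /eqP fy]; first exact/eqP.
apply/eqP; apply: (addIr (f y)).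
by rewrite -fD subrK fx fy addr0.
Qed.

HB.instance Definition _ := GRing.isZmodClosed.Build G (kernel fD)
  kernel_zmod_closed.
End KernelSubgroup.

(** Some coordinate of the embedding is nonzero at [x]; its kernel has finite index because the
    coordinate group is finite. *)
Lemma residually_finite_separated (G : zmodType) : residually_finite G ->
  forall x : G, x != 0 -> exists2 H, profinite_base H & x \notin H.
Proof.
move=> [I [F [f [fD f_inj]]]] x x0.
have fiD i : {morph f^~ i : x y / x + y} by move=> y z; exact: fD.
have [i fxi] : exists i, f x i != 0.
  apply: contrapT => /forallNP fx0; case/eqP: x0; apply: f_inj.
  apply: functional_extensionality_dep => i.
  have f00 : f 0 i = 0 by apply: (addrI (f 0 i)); rewrite -fD !addr0.
  by rewrite f00; have /negP/negPn/eqP := fx0 i.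
exists (kernel (fiD i) : zmodClosed G); last exact: fxi.
apply: (@profinite_baseP _ _ (F i) (f^~ i)) => y z yz.
by apply/eqP; apply: (addIr (f z i)); rewrite add0r -fD subrK.
Qed.

(** Subgroups as plain sets, to which Zorn's lemma for unions of chains applies. *)
Definition set_zmod_closed (G : zmodType) (A : set G) :=
  A 0 /\ forall x y, A x -> A y -> A (x - y).

Section SetSubgroup.
Variables (G : zmodType) (A : set G) (Acl : set_zmod_closed A).

Definition set_subgroup of set_zmod_closed A : {pred G} := fun x => `[< A x >].

Lemma set_subgroup_closed : zmod_closed (set_subgroup Acl).
Proof.
have [A0 AB] := Acl; split; first exact/asboolP.
by move=> x y /asboolP Ax /asboolP Ay; apply/asboolP/AB.
Qed.

HB.instance Definition _ := GRing.isZmodClosed.Build G (set_subgroup Acl)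
  set_subgroup_closed.
End SetSubgroup.

Lemma set_zmod_closed_bigcup (G : zmodType) (F : set (set G)) : F !=set0 ->
  F `<=` @set_zmod_closed G -> total_on F subset ->
  set_zmod_closed (\bigcup_(A in F) A).
Proof.
move=> [A0 FA0] Fcl Ftot; split; first by exists A0 => //; exact: (Fcl _ FA0).1.
move=> x y [A FA Ax] [A' FA' Ay].
by have [AA'|A'A] := Ftot _ _ FA FA'; [exists A' => //|exists A => //];
  apply: (Fcl _ _).2 => //; [exact: AA'|exact: A'A].
Qed.

(* A subgroup [M] containing [pG] and maximal among those avoiding [x] has
   index [p]: for [y] not in [M], the point [x] is in [M + Zy], hence [y] is in
   [M + Zx]. *)
Lemma separating_subgroup (G : zmodType) (p : nat) (H : set G) (x : G) :
  prime p -> set_zmod_closed H -> (forall y, H (y *+ p)) -> ~ H x ->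
  exists M : zmodClosed G,
    [/\ profinite_base M, forall y, H y -> y \in M & x \notin M].
Proof.
move=> p_pr Hcl pGH nHx.
have [//|F F0 FP Ftot|M [[Mcl nMx] HM Mmax]] :=
    @Zorn_bigcup_above G [set M | set_zmod_closed M /\ ~ M x] H.
  split; last by move=> [M /FP[_ nMx]].
  by apply: set_zmod_closed_bigcup => // M /FP[].
have [M0 MB] := Mcl.
have MN y : M y -> M (- y) by move=> My; rewrite -sub0r; exact: MB.
have MD y z : M y -> M z -> M (y + z).
  by move=> My Mz; rewrite -[z]opprK; apply/MB/MN.
have MMn y k : M y -> M (y *+ k).
  by move=> My; elim: k => [|k IHk]; rewrite ?mulr0n ?mulrS//; exact: MD.
have pM y k : M (y *+ (p * k)) by rewrite mulnC mulrnA; exact/HM.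
have index_p y : exists i : 'I_p, M (y - x *+ i).
  have [My|nMy] := pselect (M y).
    by exists (Ordinal (prime_gt0 p_pr)); rewrite mulr0n subr0.
  (* This is M + Zy, natural multiples being enough since py is in [M]. It properly contains [M], so
     by maximality it contains [x]. *)
  pose M' : set G := [set z | exists k, M (z - y *+ k)].
  have [k Mk] : M' x.
    apply: contrapT => nM'x; apply: (Mmax M'); last first.
      split=> //; split; first by exists 0%N; rewrite mulr0n subr0.
      (* The coefficient -l is replaced by (p - 1)l, which agrees with it modulo p. *)
      move=> z w [k Mz] [l Mw]; exists (k + p.-1 * l)%N.
      suff -> : z - w - y *+ (k + p.-1 * l) =
          (z - y *+ k) - (w - y *+ l) - y *+ (p * l).
        by apply/MB/pM; exact: MB.
      rewrite -{2}(prednK (prime_gt0 p_pr)) mulSn !mulrnDr opprB !opprD.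
      by rewrite [RHS](AC (2*2*2) ((1*4)*(2*6)*(3*5)))/= subrr addr0.
    split; first by move=> z Mz; exists 0%N; rewrite mulr0n subr0.
    by move=> M'M; apply/nMy/M'M; exists 1%N; rewrite subrr.
  (* If p divided k, then ky, and with it [x], would lie in [M]. *)
  have kp : coprime k p.
    rewrite coprime_sym prime_coprime//; apply/negP => /dvdnP[q kE].
    apply: nMx; rewrite -(subrK (y *+ k) x) kE mulnC; apply: MD => //.
    by rewrite mulnC -kE.
  have k0 : (0 < k)%N.
    case: k kp {Mk} => //; rewrite /coprime gcd0n => /eqP p1.
    by rewrite p1 in p_pr.
  (* The Bezout relation uk = vp + 1 turns x = ky modulo [M] into y = ux modulo [M]; as px is in
     [M], u may be reduced modulo p. *)
  have [u v uv _] := egcdnP p k0; rewrite (eqP kp) in uv.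
  exists (Ordinal (ltn_pmod u (prime_gt0 p_pr))) => /=.
  have -> : y - x *+ (u %% p) =
      - ((x - y *+ k) *+ u) + x *+ (p * (u %/ p)) - y *+ (p * v).
    have uE : x *+ u = x *+ (p * (u %/ p)) + x *+ (u %% p).
      by rewrite -mulrnDr mulnC -divn_eq.
    rewrite mulrnBl -mulrnA (mulnC k) uv mulrnDr mulr1n uE (mulnC v).
    rewrite opprB opprD [RHS](AC ((2*2)*1*1) ((2*4)*((1*6)*(3*5))))/=.
    by rewrite subrr addNr !addr0.
  by apply: MB; [apply: MD|]; [exact/MN/MMn| |]; exact: pM.
exists (set_subgroup Mcl : zmodClosed G); split.
(* The residue [i y] determines the coset of [y] modulo [M], so there are at most p cosets. *)
- have /choice[i iP] := index_p.
  apply: (@profinite_baseP _ _ _ i) => y z yz; apply/asboolP.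
  have -> : y - z = (y - x *+ i y) - (z - x *+ i y).
    by rewrite opprB addrA subrK.
  by apply: MB; rewrite // yz.
- by move=> y Hy; apply/asboolP/HM.
- by apply/asboolP.
Qed.

(* [D] generates [G] modulo [pG], since every subgroup containing [pG] is
   closed in the profinite topology. *)
Lemma card_quot_dense (G : zmodType) (p : nat)
    (D : set (profinite_topology G)) :
  prime p -> dense D -> infinite_set [set: D] ->
  [set: Quotient.quot (multiples G p)] #<= [set: D].
Proof.
move=> p_pr denseD Dinf.
(* Differences of two such sums are exactly the integer combinations of elements of [D]. *)
pose comb (s : seq D * seq D) : G :=
  \sum_(d <- s.1) (val d : G) - \sum_(d <- s.2) (val d : G).
pose H : set G := [set x | exists s, x - comb s \in multiples G p].
have Hcl : set_zmod_closed H.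
  split; first by exists ([::], [::]); rewrite /comb !big_nil !subrr rpred0.
  move=> x y [[s s'] xs] [[t t'] yt]; exists (s ++ t', s' ++ t).
  have -> : x - y - comb (s ++ t', s' ++ t) =
      (x - comb (s, s')) - (y - comb (t, t')).
    rewrite /comb/= !big_cat/= !opprB !opprD.
    by rewrite [LHS](AC (2*(2*2)) ((1*(3*5))*((4*6)*2))).
  exact: rpredB.
have pGH y : H (y *+ p).
  exists ([::], [::]); rewrite /comb !big_nil !subr0.
  by apply/asboolP; exists y.
have DH (d : D) : H (val d).
  by exists ([:: d], [::]); rewrite /comb/= big_nil big_seq1 subr0 subrr rpred0.
have HT x : H x.
  apply: contrapT => nHx.
  have [M [finM HM nMx]] := separating_subgroup p_pr Hcl pGH nHx.
  (* The open coset of [x] modulo [M] meets [D], which lies in [M]; this forces [x] into [M]. *)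
  have [||y [xy Dy]] := denseD (translate M x).
  - by exists x; exact: translate_refl.
  - exact: translate_open.
  - have yM : y \in M by exact: (HM _ (DH (exist _ y (mem_set Dy)))).
    by move: nMx; rewrite -(subKr y x) rpredB.
apply: card_le_trans (infinite_card_square Dinf).
have seqD := infinite_card_seq Dinf.
apply: card_le_trans (card_leT_prod seqD seqD).
apply: (card_leT_surj
  (f := fun s => \pi_(Quotient.quot (multiples G p)) (comb s))).
move=> x; have [s xs] := HT (repr x); exists s.
by apply/eqP; rewrite eq_sym -[x]reprK -Quotient.idealrBE.
Qed.

(* The fibres of [f] refine the cosets of [mG]: a colouring of [G/qG] and one
   of [G/nG] are combined by writing [x] as a representative modulo [qG] plus
   [qz] and colouring [z] modulo [nG]. *)
Lemma card_quot_multiples (G : zmodType) (K : Type) : infinite_set [set: K] ->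
  (forall p, prime p -> [set: Quotient.quot (multiples G p)] #<= [set: K]) ->
  forall m, (0 < m)%N ->
    exists f : G -> K, forall x y, f x = f y -> x - y \in multiples G m.
Proof.
move=> Kinf primeK; have /card_leTP[j j_inj] := infinite_card_square Kinf.
elim/ltn_ind => m IHm m0; have [m1|m1] := leqP m 1.
  have [k _] := infinite_setN0 Kinf; exists (fun=> k) => x y _.
  have -> : m = 1%N by apply/eqP; rewrite eqn_leq m1.
  by apply/asboolP; exists (x - y); rewrite mulr1n.
have q_pr := pdiv_prime m1; set q := pdiv m in q_pr.
have mE : m = (q * (m %/ q))%N by rewrite mulnC divnK// pdiv_dvd.
have n0 : (0 < m %/ q)%N by move: m0; rewrite {1}mE muln_gt0 => /andP[].
have nm : (m %/ q < m)%N by rewrite ltn_Pdiv ?prime_gt1.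
have [g gP] := IHm _ nm n0.
have /card_leTP[h h_inj] := primeK _ q_pr.
pose c x := \pi_(Quotient.quot (multiples G q)) x.
have /choice[z zP] (x : G) : exists z, x - repr (c x) = z *+ q.
  by apply/asboolP; change (x - repr (c x) \in multiples G q);
    rewrite Quotient.idealrBE reprK.
exists (fun x => j (h (c x), g (z x))) => x y.
move=> /j_inj[/h_inj cxy /gP/asboolP[w wE]].
apply/asboolP; exists w; rewrite mE mulnC mulrnA -wE mulrnBl -!zP cxy.
by rewrite opprB addrA subrK.
Qed.

(** * Inequalities between the invariants of G *)

Lemma cardinal_mul_le (k l m : cardinal) : cardinal_le omega m ->
  cardinal_le k m -> cardinal_le l m -> cardinal_le (cardinal_mul k l) m.
Proof.
rewrite -{1}(carrierK m) => /card_of_le/infiniteP m_inf km lm.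
rewrite -(carrierK m); apply/card_of_le.
exact: card_le_trans (card_leT_prod km lm) (infinite_card_square m_inf).
Qed.

Lemma cardinal_le_mull (k l : cardinal) : [set: carrier l] !=set0 ->
  cardinal_le k (cardinal_mul k l).
Proof.
move=> [y _]; rewrite -{1}(carrierK k); apply/card_of_le/card_leTP.
by exists (fun x => (x, y)) => x x' [].
Qed.

Lemma cardinal_le_mulr (k l : cardinal) : [set: carrier k] !=set0 ->
  cardinal_le l (cardinal_mul k l).
Proof.
move=> [x _]; rewrite -{1}(carrierK l); apply/card_of_le/card_leTP.
by exists (fun y => (x, y)) => y y' [].
Qed.

Lemma omega_le (X : Type) :
  infinite_set [set: X] -> cardinal_le omega (card_of X).
Proof. by move=> /infiniteP NX; apply/card_of_le. Qed.

Section ResiduallyFinite.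
Variables (G : zmodType) (Ginf : infinite_set [set: G])
  (resG : residually_finite G).

Local Notation K := (cardinal_mul omega
  (cardinal_sup (fun p : {p : nat | prime p} =>
     card_of (Quotient.quot (multiples G (val p)))))).

Lemma profinite_accessible : accessible_space (profinite_topology G).
Proof. exact/subgroup_accessible/residually_finite_separated. Qed.

Lemma natural_accessible : accessible_space (natural_topology G).
Proof.
apply: subgroup_accessible => x /(residually_finite_separated resG)[H finH xH].
have [L natL LH] := natural_base_profinite finH.
by exists L => //; apply: contra xH => /LH.
Qed.

Lemma profinite_open_natural (A : set G) :
  @open (profinite_topology G) A -> @open (natural_topology G) A.
Proof.
by apply: subgroup_topology_finer => H; exact: natural_base_profinite.
Qed.

(** A set that is dense for the natural topology is dense for the coarser profinite one. *)
Lemma profinite_density_le_natural :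
  cardinal_le (density (profinite_topology G)) (density (natural_topology G)).
Proof.
have [D denseD ->] := densityP (natural_topology G).
apply: (@density_le (profinite_topology G)) => A A0 oA.
exact/denseD/profinite_open_natural.
Qed.

Lemma mul_sup_quot_le_density : cardinal_le K (density (profinite_topology G)).
Proof.
have [D denseD ->] := densityP (profinite_topology G).
have Dinf : infinite_set [set: D].
  rewrite (eq_finite_set (card_setT D)).
  exact: dense_infinite profinite_accessible Ginf denseD.
apply: cardinal_mul_le; try exact: omega_le.
apply: cardinal_sup_le => -[p p_pr]; apply/card_of_le.
exact: card_quot_dense.
Qed.

Lemma natural_weight_le_mul_sup_quot :
  cardinal_le (weight (natural_topology G)) K.
Proof.
have quotK (p : nat) : prime p ->
    [set: Quotient.quot (multiples G p)] #<= [set: carrier K].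
  move=> p_pr; apply/card_of_le; rewrite carrierK.
  apply: cardinal_le_trans (cardinal_le_mulr _ _).
    exact: (cardinal_sup_ge (fun p : {p : nat | prime p} =>
      card_of (Quotient.quot (multiples G (val p)))) (exist _ p p_pr)).
  have := carrier_card_of nat; rewrite card_eq_sym card_eq_le.
  move=> /andP[/card_leTP[f _] _].
  by exists (f 0%N).
have Kinf : infinite_set [set: carrier K].
  apply/infiniteP/card_of_le; rewrite carrierK; apply: cardinal_le_mull.
  (* The factor omega makes the product infinite once the supremum is nonempty; G/2G, which contains
     0, shows that it is. *)
  have := cardinal_sup_ge (fun p : {p : nat | prime p} =>
      card_of (Quotient.quot (multiples G (val p)))) (exist _ 2%N isT).
  rewrite -[X in cardinal_le _ X]carrierK => /card_of_le/card_leTP[f _].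
  by exists (f 0).
have /choice[f fP] (m : nat) : exists f : G -> carrier K,
    (0 < m)%N -> forall x y, f x = f y -> x - y \in multiples G m.
  have [m0|m0] := posnP m; last first.
    by have [f fP] := card_quot_multiples Kinf quotK m0; exists f.
  have [k _] := infinite_setN0 Kinf.
  by exists (fun=> k); rewrite m0.
pose B : set (set (natural_topology G)) :=
  [set U | exists m x, (0 < m)%N /\ U = translate (multiples G m) x].
have basisB : basis B.
  split=> [_ [m [x [m0 ->]]]|x A].
    by apply: translate_open; exists m.
  move=> [_ [m m0 <-] HA]; exists (translate (multiples G m) x) => //.
  by split; [exists m, x|exact: translate_refl].
apply: cardinal_le_trans (weight_le basisB) _; rewrite -(carrierK K).
apply/card_of_le.
apply: card_le_trans (infinite_card_square Kinf).
have NK : [set: nat] #<= [set: carrier K] by apply/infiniteP.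
apply: card_le_trans (card_leT_prod NK (card_lexx _)).
have /choice[r rP] (U : B) : exists u : nat * G,
    (0 < u.1)%N /\ val U = translate (multiples G u.1) u.2.
  by have [m [x [m0 UE]]] := set_mem (valP U); exists (m, x).
(* A basic set is coded by its modulus m and the colour of a chosen representative: for one modulus,
   equal colours mean equal cosets. *)
apply/card_leTP; exists (fun U => ((r U).1, f (r U).1 (r U).2)) => U V [rUV].
have [m0 UE] := rP U; have [_ VE] := rP V.
rewrite -rUV in VE *; move=> /(fP _ m0) UV; apply: val_inj; rewrite UE VE.
apply/seteqP; split=> y /= yH; rewrite /translate/=.
  by rewrite -(subrKA (r U).2) rpredD.
by rewrite -(subrKA (r V).2) rpredD// -opprB rpredN.
Qed.

Lemma log_card_le_natural_weight :
  cardinal_le (cardinal_log (card_of G)) (weight (natural_topology G)).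
Proof.
apply: prop_cardinal_min; apply: (@card_le_exp2_weight (natural_topology G)).
exact: accessible_kolmogorov natural_accessible.
Qed.

End ResiduallyFinite.

Theorem theorem3p6 (G : zmodType) :
  infinite_set [set: G] -> residually_finite G ->
  [/\ cardinal_le (cardinal_log (card_of G)) (weight (natural_topology G)),
      weight (natural_topology G) = density (profinite_topology G),
      density (profinite_topology G) = density (natural_topology G) &
      density (natural_topology G) =
        cardinal_mul omega
          (cardinal_sup (fun p : {p : nat | prime p} =>
             card_of (Quotient.quot (multiples G (val p)))))].
Proof.
move=> Ginf resG.
have wK := natural_weight_le_mul_sup_quot G.
have Kd := mul_sup_quot_le_density Ginf resG.
have dd := profinite_density_le_natural G.
have dw := @density_le_weight (natural_topology G).
(* With K the right-hand cardinal, the inequalities form a cycle: w(natural) <= K <= d(profinite) <=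
   d(natural) <= w(natural). *)
split.
- exact: log_card_le_natural_weight.
- apply: cardinal_le_anti; first exact: cardinal_le_trans wK Kd.
  exact: cardinal_le_trans dd dw.
- apply: cardinal_le_anti => //.
  by apply: cardinal_le_trans dw _; exact: cardinal_le_trans wK Kd.
- apply: cardinal_le_anti; first exact: cardinal_le_trans dw wK.
  exact: cardinal_le_trans Kd dd.
Qed.
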